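(* Let $p$ be a prime number. For any $n\in W$ with $n_p\notin\mathbb{N}$, the unitary Banach $\mathbb{C}_p$-linear representation $(\mathrm{C}_0(\mathbb{N},\mathbb{C}_p),\rho_n)$ of $B$ is weakly irreducible.
   Context: $\mathbb{N}$ contains $0$. $O_{\mathbb{C}_p}$ is the valuation ring of $\mathbb{C}_p$. For a matrix $U\in\mathrm{GL}_2(\mathbb{Z}_p)$ and $i,j\in\{0,1\}$, $U_{i,j}$ is the $(1+i,1+j)$-entry. $B=\{U\in\mathrm{GL}_2(\mathbb{Z}_p) : U_{1,0}\in p\mathbb{Z}_p\}$. Put $q_p=4$ if $p=2$ and $q_p=p$ otherwise. $W$ is the group, written additively, of continuous characters $n\colon\mathbb{Z}_p^{\times}\to\mathbb{C}_p^{\times}$ for which there is an exponent $n_p\in O_{\mathbb{C}_p}$ with $n(u)=\exp(n_p\log u)$ for all $u\in 1+q_p\mathbb{Z}_p$ (such an $n_p$ is unique). One writes $u^n$ for $n(u)$, and $\mathbb{Z}\subset W$ through $m\mapsto(u\mapsto u^m)$. For $n\in W$, $i\in\mathbb{N}$, $\binom{n}{i}=\frac{1}{i!}\prod_{h=0}^{i-1}(n_p-h)\in\mathbb{C}_p$. $\mathrm{C}_0(\mathbb{N},\mathbb{C}_p)$ is the Banach space, with supremum norm, of sequences $v\colon\mathbb{N}\to\mathbb{C}_p$ converging to $0$. For $(n,i,j)\in W\times\mathbb{N}^2$ and $U\in B$, $$\rho_{n,i,j}(U)=\sum_{h=0}^{\min\{i,j\}}\binom{n-j}{i-h}\binom{j}{h}U_{0,0}^{n-i-j+h}U_{0,1}^{j-h}U_{1,0}^{i-h}U_{1,1}^{h}\in\mathbb{C}_p,$$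 and $\rho_n\colon B\times\mathrm{C}_0(\mathbb{N},\mathbb{C}_p)\to\mathrm{C}_0(\mathbb{N},\mathbb{C}_p)$ is the map $(U,v)\mapsto\bigl(\sum_{j\in\mathbb{N}}\rho_{n,i,j}(U)v(j)\bigr)_{i\in\mathbb{N}}$, which is the unitary Banach $\mathbb{C}_p$-linear representation in question (unitary: a continuous $\mathbb{C}_p$-linear action by isometries). The weak topology of a Banach $\mathbb{C}_p$-vector space $V$ is the weakest topology for which every $\mathbb{C}_p$-linear map $m\colon V\to\mathbb{C}_p$ with $|m(v)|\le\|v\|$ for all $v$ is continuous. A unitary Banach representation is weakly irreducible if it admits precisely two subrepresentations (i.e. $B$-stable $\mathbb{C}_p$-linear subspaces) that are closed in the weak topology.
   Formalization: For p = 2 it is additionally assumed that ρ_n maps B × C_0(N, C_p) into C_0(N, C_p); this fails for some n (e.g. n_p a primitive cube root of unity), where (C_0(N, C_p), ρ_n) is not a representation. For odd p nothing is added. *)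

(* Defs.v *)
From HB Require Import structures.
From mathcomp Require Import all_boot all_order all_algebra.
From mathcomp Require Import all_classical all_reals topology.

Set Implicit Arguments.
Unset Strict Implicit.
Unset Printing Implicit Defensive.

Import Order.TTheory GRing.Theory Num.Theory.
Local Open Scope classical_set_scope.
Local Open Scope ring_scope.

(* A field that is complete for the metric |x - y| of a (multiplicative)
   ultrametric absolute value |.| with values in R. *)
HB.mixin Record isUltrametricField (R : realType) K
    & GRing.Field K & CompletePseudoMetric R K := {
  vabs : K -> R;
  vabs_ge0 : forall x : K, 0 <= vabs x;
  vabs_eq0 : forall x : K, vabs x = 0 <-> x = 0;
  vabsM : forall x y : K, vabs (x * y) = vabs x * vabs y;
  vabsD_max : forall x y : K, vabs (x + y) <= Num.max (vabs x) (vabs y);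
  ball_vabs : forall (x : K) (e : R), ball x e = [set y : K | vabs (x - y) < e]
}.

#[short(type="ultrametricFieldType")]
HB.structure Definition UltrametricField (R : realType) :=
  {K of isUltrametricField R K & GRing.Field K & CompletePseudoMetric R K}.

Section QpInside.
Context (R : realType) (K : ultrametricFieldType R).

(* As K is complete, the closure of the image of Q is the completion of Q for
   the induced absolute value. *)
Definition Qp : set K := closure (range (ratr : rat -> K)).

Definition Qp_poly (P : {poly K}) : Prop := forall i, Qp P`_i.

Definition Qpbar : set K :=
  [set x | exists P : {poly K}, [/\ P != 0, Qp_poly P & root P x]].

End QpInside.

(* C_p, i.e. the completion of an algebraic closure of Q_p: by vabs_p the
   absolute value restricts to the p-adic one on Q, so Qp is the field of
   p-adic numbers; by Qp_poly_root the field Qpbar is an algebraic closure of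
   Qp; and K, which is complete, contains Qpbar as a dense subfield.  These
   properties determine K with its absolute value up to isomorphism. *)
HB.mixin Record isPadicComplex (R : realType) (p : nat) K
    & UltrametricField R K := {
  vabs_p : vabs (p%:R : K) = (p%:R : R)^-1;
  Qp_poly_root : forall P : {poly K}, Qp_poly P -> (1 < size P)%N ->
    exists x, root P x;
  Qpbar_dense : closure (@Qpbar R K) = setT
}.

#[short(type="padicComplexType")]
HB.structure Definition PadicComplex (R : realType) (p : nat) :=
  {K of isPadicComplex R p K & UltrametricField R K}.

Section ZeroSequences.
Context (R : realType) (K : ultrametricFieldType R).

Definition tends_to0 : {pred nat -> K^o} :=
  fun v => `[< (v : nat -> K) @ \oo --> (0 : K) >].

Lemma tends_to0P (v : nat -> K^o) :
  reflect (forall e : R, 0 < e ->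
             \forall i \near \oo, vabs (v i : K) < e)
          (v \in tends_to0).
Proof.
have E (x : K) (e : R) : ball (0 : K) e x = (vabs x < e) :> Prop.
  rewrite ball_vabs /= sub0r; congr is_true; congr (_ < _).
  have N1 : vabs (-1 : K) = 1.
    have one : vabs (1 : K) = 1.
      have n0 : vabs (1 : K) != 0.
        by apply/eqP => /vabs_eq0 /eqP; rewrite oner_eq0.
      by apply: (mulfI n0); rewrite -vabsM !mulr1.
    apply/eqP; rewrite -(eqrXn2 (ltn0Sn 1)) ?vabs_ge0 ?ler01 //.
    by rewrite !expr2 -vabsM mulrNN !mulr1 one.
  by rewrite -mulN1r vabsM N1 mul1r.
apply: (iffP (asboolP _)) => [/cvg_ballP h e e0|h].
  by have := h e e0; apply: filterS => i; rewrite E.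
apply/cvg_ballP => e e0; have := h e e0.
by apply: filterS => i; rewrite E.
Qed.

Lemma tends_to0_submod_closed : submod_closed tends_to0.
Proof.
split.
  apply/tends_to0P => e e0; apply: nearW => i.
  by rewrite (_ : vabs _ = 0) //; apply/vabs_eq0.
move=> a u v /tends_to0P hu /tends_to0P hv; apply/tends_to0P => e e0.
have a1 : 0 < vabs (a : K) + 1 by rewrite ltr_wpDl ?vabs_ge0.
have := hu _ (divr_gt0 e0 a1); have := hv e e0.
apply: filterS2 => i vi ui.
apply: le_lt_trans (vabsD_max _ _) _; rewrite gt_max vi andbT.
rewrite [vabs _]vabsM; move: ui; rewrite ltr_pdivlMr // => ui.
apply: le_lt_trans ui; rewrite mulrC ler_wpM2l ?vabs_ge0 //.
by rewrite lerDl.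
Qed.

HB.instance Definition _ :=
  GRing.isSubmodClosed.Build K (nat -> K^o) tends_to0 tends_to0_submod_closed.

Record c0 := C0 { c0_val :> nat -> K^o; _ : c0_val \in tends_to0 }.

HB.instance Definition _ := [isSub for c0_val].
HB.instance Definition _ := [Choice of c0 by <:].
HB.instance Definition _ := [SubChoice_isSubLmodule of c0 by <:].

Definition c0_norm (v : c0) : R := sup (range (fun i => vabs (v i : K))).

(* The linear forms m with |m(v)| <= ||v|| for all v. *)
Definition dual_ball : Type :=
  {m : {scalar c0} | forall v, vabs (m v : K) <= c0_norm v}.

Definition dual_eval (m : dual_ball) (v : c0) : K := sval m v.

Definition weak_topology : topologicalType :=
  sup_topology (fun m : dual_ball =>
    Topological.class (initial_topology (dual_eval m))).

Definition weakly_closed (A : set c0) : Prop :=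
  closed (A : set weak_topology).

Definition c0_subspace (A : set c0) : Prop :=
  A 0 /\ forall (a : K) u v, A u -> A v -> A (a *: u + v).

End ZeroSequences.

Section Representation.
Context (R : realType) (p : nat) (K : padicComplexType R p).

Definition padic_int : set K := [set x | Qp x /\ vabs x <= 1].

Definition padic_unit : set K := [set x | padic_int x /\ exists2 y, padic_int y & x * y = 1].

Definition GL2Zp : set 'M[K]_2 :=
  [set U | [/\ U \in unitmx, forall i j, padic_int (U i j) &
                             forall i j, padic_int (invmx U i j)]].

Definition iwahori : set 'M[K]_2 :=
  [set U | GL2Zp U /\ exists2 x, padic_int x & U 1 0 = p%:R * x].

Definition padic_exp (x : K) : K := limn (fun N => \sum_(0 <= k < N) x ^+ k / k`!%:R).

Definition padic_log (u : K) : K :=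
  limn (fun N => \sum_(1 <= k < N) (-1) ^+ k.+1 * (u - 1) ^+ k / k%:R).

Definition q_p : nat := if p == 2%N then 4%N else p.

(* The group W.  A character is represented by a function on K of which only
   the restriction to padic_unit matters; wexp is the exponent n_p, which the
   character determines; wfunM and wfun_neq0 imply that 1 is mapped to 1. *)
Record weight := Weight {
  wfun :> K -> K;
  wexp : K;
  wfun_neq0 : forall u, padic_unit u -> wfun u != 0;
  wfunM : forall u v, padic_unit u -> padic_unit v -> wfun (u * v) = wfun u * wfun v;
  wfun_continuous : {within padic_unit, continuous wfun};
  wexp_le1 : vabs wexp <= 1;
  wfunE : forall x, padic_int x ->
    wfun (1 + q_p%:R * x) = padic_exp (wexp * padic_log (1 + q_p%:R * x))
}.

(* u^(n + m) for n in W and m in Z, where W is written additively *)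
Definition wpow (n : weight) (m : int) (u : K) : K := n u * u ^ m.

(* binom(n, i) for n in W of exponent s *)
Definition wbinom (s : K) (i : nat) : K :=
  (i`!%:R)^-1 * \prod_(0 <= h < i) (s - h%:R).

(* n - j has exponent n_p - j. *)
Definition rho_coef (n : weight) (i j : nat) (U : 'M[K]_2) : K :=
  \sum_(0 <= h < (minn i j).+1)
    wbinom (wexp n - j%:R) (i - h) * 'C(j, h)%:R
    * wpow n (h%:Z - i%:Z - j%:Z) (U 0 0)
    * U 0 1 ^+ (j - h) * U 1 0 ^+ (i - h) * U 1 1 ^+ h.

Definition rho (n : weight) (U : 'M[K]_2) (v : c0 K) (i : nat) : K :=
  limn (fun N => \sum_(0 <= j < N) rho_coef n i j U * (v j : K)).

(* rho_n maps B x C_0(N, C_p) to C_0(N, C_p).  This can fail for p = 2: if n_p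
   is a primitive cube root of unity, then |n_p - h| = 1 for all h in N, so for
   U = (1 0; 2 1) the i-th coordinate binom(n, i) 2^i of rho_n(U) e_0 has
   absolute value 2^-s(i), where s(i) is the sum of the binary digits of i, and
   does not tend to 0. *)
Definition rho_c0 (n : weight) : Prop :=
  forall U v, iwahori U -> rho n U v \in @tends_to0 R K.

(* rho n U v is a priori only a sequence: stability includes that it lies in
   C_0(N, C_p). *)
Definition subrep (n : weight) (A : set (c0 K)) : Prop :=
  c0_subspace A /\
  forall U v, iwahori U -> A v -> exists2 w, A w & c0_val w = rho n U v.

Definition weakly_irreducible (n : weight) : Prop :=
  ([set A | subrep n A /\ weakly_closed A] #= `I_2)%card.

End Representation.

(* Main.v *)
Require Import Defs.
From HB Require Import structures.
From Stdlib Require List.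
From mathcomp Require Import all_boot all_order all_algebra.
From mathcomp Require Import all_classical all_reals topology.
From mathcomp Require Import ring zify.
(** Read a sequence [v] as the power series with coefficients [v j].  Then
    [rho n U] is the substitution of [(U 0 1 + U 1 1 X) / (U 0 0 + U 1 0 X)] for
    [X], followed by multiplication with [(U 0 0 + U 1 0 X) ^ n].  So diagonal
    matrices multiply the [j]-th coordinate by [d ^ j], up to a common factor,
    and the unipotent matrices move the coordinates.

    Let [A] be a weakly closed stable subspace that is not the whole space.  The
    weak topology is such that some bounded linear form [f] kills [A] but is not
    zero ([weakly_closed_separation]).  It is a relation with bounded
    coefficients [f (c0_delta j)] among the coordinates of the elements of [A].
    Such a relation splits into its weights ([weight_separation]): inserting the
    translates of [v] by diagonal matrices gives the vanishing of the power
    series with coefficients [f (c0_delta j) * v j] at infinitely many points of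
    the closed unit disc, so that all these products are 0 ([power_series_eq0]).
    As [f] is not zero, there is an index [i] such that [v i = 0] for all [v] in
    [A] ([coordinate_vanishes]).

    Now [A] is stable, so for every [U] the sum of the [rho_coef n i j U * v j]
    over [j] is 0 for all [v] in [A].  This is a relation of the same kind, hence
    [rho_coef n i j U * v j = 0] for every [j].  A unipotent [U], upper triangular
    if [i <= j] and lower triangular if [j <= i], makes the coefficient nonzero;
    in the second case it involves a binomial coefficient of [n - j], which is
    nonzero because the exponent of [n] is not a natural number.  Therefore
    [v = 0] ([vanishing_coordinate]).

    Both 0 and the whole space are weakly closed and stable.  For the whole space
    this means that [rho n U] preserves the sequences tending to 0: for odd [p]
    the powers of [U 1 0], which is divisible by [p], outweigh the denominators
    of the binomial coefficients ([rho_c0_odd]), and for [p = 2] it is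
    assumed. *)

Import Order.TTheory GRing.Theory Num.Theory.
Set Implicit Arguments.
Unset Strict Implicit.
Unset Printing Implicit Defensive.
Local Open Scope classical_set_scope.
Local Open Scope ring_scope.

(** * Ultrametric absolute values and limits *)

Section AbsoluteValue.
Context (R : realType) (K : ultrametricFieldType R).
Implicit Types (x y l : K) (e C : R) (S c : nat -> K).

Lemma vabs0 : vabs (0 : K) = 0. Proof. exact/vabs_eq0. Qed.

Lemma vabs_neq0 x : (vabs x == 0) = (x == 0).
Proof. by apply/eqP/eqP => /vabs_eq0. Qed.

Lemma vabs_gt0 x : (0 < vabs x) = (x != 0).
Proof. by rewrite lt_def vabs_ge0 vabs_neq0 andbT. Qed.

Lemma vabs1 : vabs (1 : K) = 1.
Proof.
have n0 : vabs (1 : K) != 0 by rewrite vabs_neq0 oner_eq0.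
by apply: (mulfI n0); rewrite -vabsM !mulr1.
Qed.

Lemma vabsX x k : vabs (x ^+ k) = vabs x ^+ k.
Proof. by elim: k => [|k IH]; rewrite ?expr0 ?vabs1 // !exprS vabsM IH. Qed.

Lemma vabsN x : vabs (- x) = vabs x.
Proof.
apply/eqP; rewrite -(eqrXn2 (ltn0Sn 1)) ?vabs_ge0 //.
by rewrite -!vabsX sqrrN.
Qed.

Lemma vabsBC x y : vabs (x - y) = vabs (y - x).
Proof. by rewrite -vabsN opprB. Qed.

Lemma vabsV x : vabs x^-1 = (vabs x)^-1.
Proof.
have [->|x0] := eqVneq x 0; first by rewrite invr0 vabs0 invr0.
have n0 : vabs x != 0 by rewrite vabs_neq0.
by apply: (mulfI n0); rewrite -vabsM !divff // vabs1.
Qed.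

Lemma vabs_exprz x (z : int) : vabs (x ^ z) = vabs x ^ z.
Proof. by case: z => k; rewrite ?NegzE -?exprnN -?exprnP ?exprVn ?vabsV vabsX. Qed.

Lemma vabs_sum_le (I : Type) (r : seq I) (P : pred I) (F : I -> K) C :
  0 <= C -> (forall i, P i -> vabs (F i) <= C) ->
  vabs (\sum_(i <- r | P i) F i) <= C.
Proof.
move=> C0 h; elim/big_ind : _ => //; first by rewrite vabs0.
by move=> x y hx hy; apply: le_trans (vabsD_max _ _) _; rewrite ge_max hx.
Qed.

Lemma vabs_sum_lt (I : Type) (r : seq I) (P : pred I) (F : I -> K) C :
  0 < C -> (forall i, P i -> vabs (F i) < C) ->
  vabs (\sum_(i <- r | P i) F i) < C.
Proof.
move=> C0 h; elim/big_ind : _ => //; first by rewrite vabs0.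
by move=> x y hx hy; apply: le_lt_trans (vabsD_max _ _) _; rewrite gt_max hx.
Qed.

Lemma vabs_prod_le1 (I : Type) (r : seq I) (P : pred I) (F : I -> K) :
  (forall i, P i -> vabs (F i) <= 1) -> vabs (\prod_(i <- r | P i) F i) <= 1.
Proof.
move=> h; elim/big_ind : _ => //; first by rewrite vabs1.
by move=> x y hx hy; rewrite vabsM mulr_ile1 ?vabs_ge0.
Qed.

Lemma vabs_nat_le1 k : vabs (k%:R : K) <= 1.
Proof.
elim: k => [|k IH]; first by rewrite vabs0 ler01.
by rewrite -natr1; apply: le_trans (vabsD_max _ _) _; rewrite ge_max IH vabs1 /=.
Qed.

Lemma vabsB_le1 x y : vabs x <= 1 -> vabs y <= 1 -> vabs (x - y) <= 1.
Proof.
by move=> hx hy; apply: le_trans (vabsD_max _ _) _; rewrite ge_max hx vabsN.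
Qed.

Lemma vabsD_eq x y : vabs y < vabs x -> vabs (x + y) = vabs x.
Proof.
move=> h; apply/eqP; rewrite eq_le; apply/andP; split.
  by apply: le_trans (vabsD_max _ _) _; rewrite ge_max lexx ltW.
have := vabsD_max (x + y) (- y); rewrite addrK vabsN.
by rewrite le_max [_ <= vabs y]leNgt h orbF.
Qed.

Lemma ultrametric_cvgP S l : (S @ \oo --> l) <->
  forall e, 0 < e -> \forall k \near \oo, vabs (S k - l) < e.
Proof.
have E x e : ball l e x = (vabs (x - l) < e) :> Prop.
  by rewrite ball_vabs /= vabsBC.
split=> [/cvg_ballP h e e0|h].
  by have := h e e0; apply: filterS => i; rewrite E.
by apply/cvg_ballP => e e0; have := h e e0; apply: filterS => i; rewrite E.
Qed.

Lemma ultrametric_hausdorff : hausdorff_space K.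
Proof.
move=> x y; apply: contraPP => xy /(_ (ball x _) (ball y _)) h.
have d0 : 0 < vabs (x - y) by rewrite vabs_gt0 subr_eq0; exact/eqP.
have [z []] := h _ _ (nbhsx_ballx x _ d0) (nbhsx_ballx y _ d0).
rewrite !ball_vabs /= => xz yz; apply: (negP (negbT (ltxx (vabs (x - y))))).
rewrite -{1}(subrK z x) -addrA; apply: le_lt_trans (vabsD_max _ _) _.
by rewrite gt_max xz (vabsBC z) yz.
Qed.

Lemma ultrametric_limn S l : S @ \oo --> l -> limn S = l.
Proof. exact: (cvg_lim ultrametric_hausdorff). Qed.

Lemma limn_near_cst S l N : (forall k, (N <= k)%N -> S k = l) -> limn S = l.
Proof.
move=> h; apply: ultrametric_limn; apply/ultrametric_cvgP => e e0.
by exists N => // k /= /h ->; rewrite subrr vabs0.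
Qed.

(** Closed balls around 0 are closed: a limit of larger absolute value would
    share it with the members of the sequence that are near to it. *)
Lemma vabs_lim_le S l C :
  S @ \oo --> l -> (forall k, vabs (S k) <= C) -> vabs l <= C.
Proof.
move=> /ultrametric_cvgP h hC; rewrite leNgt; apply/negP => lC.
have l0 : 0 < vabs l.
  by apply: le_lt_trans lC; apply: le_trans (hC 0%N); exact: vabs_ge0.
have [N _ /(_ N (leqnn N))] := h _ l0.
rewrite vabsBC => hN; have := hC N.
by rewrite -(subrK l (S N)) addrC vabsD_eq ?(vabsBC (S N)) // leNgt lC.
Qed.

(** The difference of two partial sums is at most the largest term between
    them, so it suffices that the terms tend to 0. *)
Lemma ultrametric_series_cvg c :
  (forall e, 0 < e -> \forall k \near \oo, vabs (c k) < e) ->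
  exists l : K, (fun N => \sum_(0 <= j < N) c j) @ \oo --> l.
Proof.
move=> hc; pose S N := \sum_(0 <= j < N) c j.
apply/(@cvg_ex K (S @ \oo)).
apply: cauchy_cvg; apply: cauchy_exP => e e0.
have [N _ hN] := hc e e0; exists (S N), N => // k /= Nk.
rewrite ball_vabs /= vabsBC /S (big_cat_nat (n := N)) //= addrAC subrr add0r.
rewrite big_nat.
by apply: vabs_sum_lt => // i /andP[Ni _]; apply: hN.
Qed.

End AbsoluteValue.

(** * Bounded linear forms and the weak topology *)

Section BoundedForms.
Context (R : realType) (K : ultrametricFieldType R).
Implicit Types (u v w : c0 K) (A : set (c0 K)).

Lemma c0_bounded v : exists2 C : R, 0 < C & forall i, vabs (v i : K) <= C.
Proof.
have /tends_to0P /(_ 1 ltr01) [N _ hN] := valP v.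
have S0 : 0 <= \sum_(i < N) vabs (v i : K).
  by apply: sumr_ge0 => i _; exact: vabs_ge0.
exists (\sum_(i < N) vabs (v i : K) + 1) => [|i]; first by rewrite ltr_wpDl.
have [Ni|iN] := leqP N i.
  by apply: ltW; apply: lt_le_trans (hN i Ni) _; rewrite lerDr.
rewrite (bigD1 (Ordinal iN)) //= -addrA lerDl addr_ge0 //.
by apply: sumr_ge0 => j _; exact: vabs_ge0.
Qed.

Lemma c0_bounded_mul (L : nat -> K) (C : R) v : (forall j, vabs (L j) <= C) ->
  forall e : R, 0 < e -> \forall j \near \oo, vabs (L j * (v j : K)) < e.
Proof.
move=> hC e e0; have C0 : 0 <= C := le_trans (vabs_ge0 _) (hC 0%N).
have C1 : 0 < C + 1 by rewrite ltr_wpDl.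
have /tends_to0P /(_ _ (divr_gt0 e0 C1)) := valP v.
apply: filterS => j; rewrite ltr_pdivlMr // => hj; rewrite vabsM mulrC.
apply: le_lt_trans hj; rewrite ler_wpM2l ?vabs_ge0 //.
by apply: le_trans (hC j) _; rewrite lerDl.
Qed.

Lemma vabs_coord_le v i : vabs (v i : K) <= c0_norm v.
Proof.
have [C _ hC] := c0_bounded v.
by apply: ub_le_sup; [exists C => _ [k _ <-] | exists i].
Qed.

Lemma c0_norm_le v (C : R) : (forall i, vabs (v i : K) <= C) -> c0_norm v <= C.
Proof.
by move=> h; apply: ge_sup => [|_ [k _ <-]//]; exists (vabs (v 0%N : K)); exists 0%N.
Qed.

Lemma c0_norm_ge0 v : 0 <= c0_norm v.
Proof. exact: le_trans (vabs_ge0 _) (vabs_coord_le v 0). Qed.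

Lemma c0_delta_subproof j : (fun i => (i == j)%:R : K^o) \in @tends_to0 R K.
Proof.
apply/tends_to0P => e e0; exists j.+1 => // i /= ji.
by rewrite gtn_eqF // vabs0.
Qed.

Definition c0_delta j : c0 K := C0 (c0_delta_subproof j).

(** The constant is arbitrary, so that these forms, unlike those of norm at
    most 1, are closed under linear combinations. *)
Definition bounded_form (m : c0 K -> K) : Prop :=
  (forall a u v, m (a *: u + v) = a * m u + m v) /\
  exists C : R, forall v, vabs (m v) <= C * c0_norm v.

Lemma bounded_form0 m : bounded_form m -> m 0 = 0.
Proof.
move=> [lin _]; have := lin 1 0 0; rewrite scaler0 addr0 mul1r.
by move/eqP; rewrite -subr_eq0 opprD addrA subrr sub0r oppr_eq0 => /eqP.
Qed.

Lemma bounded_formD m u v : bounded_form m -> m (u + v) = m u + m v.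
Proof. by move=> [lin _]; rewrite -[u]scale1r lin mul1r scale1r. Qed.

Lemma bounded_formZ m a u : bounded_form m -> m (a *: u) = a * m u.
Proof. by move=> hm; rewrite -[a *: u]addr0 hm.1 (bounded_form0 hm) addr0. Qed.

Lemma bounded_formB m u v : bounded_form m -> m (u - v) = m u - m v.
Proof.
by move=> hm; rewrite bounded_formD // -scaleN1r bounded_formZ // mulN1r.
Qed.

Lemma bounded_form_dual (m : dual_ball K) : bounded_form (dual_eval m).
Proof.
split=> [a u v|]; first exact: linearP.
by exists 1 => v; rewrite mul1r; exact: (svalP m).
Qed.

Lemma bounded_form_subZ m m' (a : K) : bounded_form m -> bounded_form m' ->
  bounded_form (fun v => m v - a * m' v).
Proof.
move=> [lin [C hC]] [lin' [C' hC']]; split=> [b u v|].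
  rewrite lin lin' mulrDr mulrBr opprD addrACA; congr (_ - _ + _).
  by rewrite !mulrA (mulrC a).
exists (Num.max C (vabs a * C')) => v.
apply: le_trans (vabsD_max _ _) _; rewrite vabsN vabsM ge_max.
apply/andP; split.
  by apply: le_trans (hC v) _; rewrite ler_wpM2r ?c0_norm_ge0 // le_max lexx.
apply: le_trans (ler_wpM2l (vabs_ge0 a) (hC' v)) _.
by rewrite mulrA ler_wpM2r ?c0_norm_ge0 // le_max lexx orbT.
Qed.

Lemma c0_addE u v i : (u + v) i = u i + v i. Proof. by []. Qed.

Lemma c0_scaleE (a : K) u i : (a *: u) i = a * (u i : K). Proof. by []. Qed.

Lemma coord_subproof i : scalar (fun v : c0 K => v i : K).
Proof. by []. Qed.

Definition coord_form i : {scalar c0 K} :=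
  HB.pack (fun v : c0 K => v i : K)
    (GRing.isLinear.Build K (c0 K) K *%R _ (coord_subproof i)).

Definition coord i : dual_ball K :=
  exist (fun m : {scalar c0 K} => forall v, vabs (m v : K) <= c0_norm v)
    (coord_form i) (fun v => vabs_coord_le v i).

(** Finitely supported sequences are dense in norm, so a bounded form is given
    by the sequence of its values on the unit vectors. *)
Lemma bounded_form_series m v : bounded_form m ->
  (fun N => \sum_(0 <= j < N) m (c0_delta j) * (v j : K)) @ \oo --> m v.
Proof.
move=> hm; have [_ [C hC]] := hm.
pose T N : c0 K := \sum_(0 <= j < N) (v j : K) *: c0_delta j.
have TE N i : T N i = if (i < N)%N then v i else 0.
  elim: N => [|N IH]; rewrite /T ?big_nil //.
  rewrite big_nat_recr // -/(T N).
  rewrite c0_addE c0_scaleE /= IH ltnS [(i <= N)%N]leq_eqVlt.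
  have [->|iN] := eqVneq i N.
    by rewrite ltnn mulr1 add0r.
  by rewrite mulr0 addr0.
have mT N : m (T N) = \sum_(0 <= j < N) m (c0_delta j) * (v j : K).
  elim: N => [|N IH]; rewrite /T ?big_nil ?bounded_form0 //.
  by rewrite !big_nat_recr //= bounded_formD // bounded_formZ // IH mulrC.
apply/ultrametric_cvgP => e e0.
have C1 : 0 < `|C| + 1 by rewrite ltr_wpDl.
have /tends_to0P /(_ _ (divr_gt0 e0 C1)) [N _ hN] := valP v.
exists N => // k /= Nk; rewrite -mT vabsBC -bounded_formB //.
have nT : c0_norm (v - T k) <= e / (`|C| + 1).
  apply: c0_norm_le => i.
  have -> : ((v - T k) i : K) = v i - T k i by [].
  rewrite TE; case: ltnP => ik; first by rewrite subrr vabs0 divr_ge0 ?ltW.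
  by rewrite subr0 ltW // hN //= (leq_trans Nk).
apply: le_lt_trans (hC _) _.
apply: le_lt_trans (ler_wpM2r (c0_norm_ge0 _) (ler_norm C)) _.
apply: le_lt_trans (ler_wpM2l (normr_ge0 C) nT) _.
rewrite mulrCA gtr_pMr // ltr_pdivrMr // mul1r ltrDl //.
Qed.

Lemma dual_eval_continuous (m : dual_ball K) :
  continuous (dual_eval m : weak_topology K -> K).
Proof.
move=> v; have h : nbhs v --> (v : weak_topology K) by [].
move: h => /cvg_sup /(_ m) h U hU.
exact: h (@initial_continuous _ _ (dual_eval m) v U hU).
Qed.

Lemma weakly_closed0 : weakly_closed [set (0 : c0 K)].
Proof.
have -> : [set (0 : c0 K)] =
    \bigcap_i (dual_eval (coord i) : weak_topology K -> K) @^-1` [set (0 : K)].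
  apply/seteqP; split=> [_ -> i _ //|v h].
  by apply/val_inj/funext => i; exact: h.
apply: closed_bigI => i _; apply: closed_comp => [v _|].
  exact: dual_eval_continuous.
exact/accessible_closed_set1/hausdorff_accessible/ultrametric_hausdorff.
Qed.

(** A weak neighbourhood of [v] constrains only finitely many forms, hence
    contains every [w] at which these forms take the same values as at [v].  It
    suffices that the filter generated by these sets of [w] converges to [v] for
    the initial topology of each single form. *)
Lemma weak_nbhs_forms A v : weakly_closed A -> ~ A v ->
  exists ms : seq (dual_ball K), forall w,
    (forall m, List.In m ms -> dual_eval m w = dual_eval m v) -> ~ A w.
Proof.
move=> clA nAv.
pose B (ms : seq (dual_ball K)) := [set w | forall m, List.In m ms ->
  dual_eval m w = dual_eval m v].
pose F : set_system (c0 K) := filter_from [set: seq (dual_ball K)] B.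
have FF : Filter F.
  apply: filter_from_filter; first by exists [::].
  move=> r s _ _; exists (r ++ s) => // w h.
  by split=> m ?; apply: h; apply/List.in_app_iff; [left|right].
have : F --> (v : weak_topology K).
  apply/cvg_sup => m U; rewrite nbhsE => -[_ [[O _ <-] Ov] OU].
  exists [:: m] => // w hw; apply: OU.
  by rewrite /preimage /= (hw m) //; left.
have : nbhs (v : weak_topology K) (~` A).
  by apply: open_nbhs_nbhs; split => //; exact: closed_openC.
by move=> h /(_ _ h) [ms _ sub]; exists ms => w hw; apply: sub.
Qed.

(** The Hahn-Banach theorem may fail over a field that is not spherically
    complete; here finite-dimensional linear algebra replaces it, because [v] is
    separated from [A] by the values of finitely many forms, and a vector outside
    a subspace of a finite-dimensional space is not killed by some linear form
    that kills the subspace.  In the induction step [A] is cut by the kernel of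
    the first form. *)
Lemma form_separation (ms : seq (dual_ball K)) A v : c0_subspace A ->
  (forall w, (forall m, List.In m ms -> dual_eval m w = dual_eval m v) ->
     ~ A w) ->
  exists2 f, bounded_form f & (forall w, A w -> f w = 0) /\ f v <> 0.
Proof.
elim: ms A v => [|m ms IH] A v [A0 Alin] h.
  by have := h 0 (fun _ => False_ind _) A0.
have hm := bounded_form_dual m.
have AD u w : A u -> A w -> A (u + w).
  by move=> Au Aw; rewrite -[u]scale1r; exact: Alin.
have AZ a u : A u -> A (a *: u).
  by move=> Au; rewrite -[a *: u]addr0; exact: Alin.
have [[b [Ab mb]]|mA0] := pselect (exists b, A b /\ dual_eval m b <> 0);
  last first.
  have mA w : A w -> dual_eval m w = 0.
    by move=> Aw; apply: contra_notP mA0 => ?; exists w.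
  have [mv|mv] := pselect (dual_eval m v = 0); last by exists (dual_eval m).
  apply: IH => // w hw Aw; apply: (h w _ Aw) => m' [<-|/hw //].
  by rewrite mv mA.
pose a : c0 K := (dual_eval m b)^-1 *: b.
have Aa : A a by exact: AZ.
have ma : dual_eval m a = 1 by rewrite bounded_formZ // mulVf //; exact/eqP.
pose A' := [set w | A w /\ dual_eval m w = 0].
have subA' : c0_subspace A'.
  split=> [|x u w [Au mu] [Aw mw]]; first by split=> //; exact: bounded_form0.
  by split; [exact: Alin | rewrite hm.1 mu mw mulr0 addr0].
have [|f hf [fA' fv]] := IH A' (v - dual_eval m v *: a) subA'.
  move=> w hw [Aw mw]; apply: (h (w + dual_eval m v *: a)); last first.
    by apply: AD => //; exact: AZ.
  move=> m' [<-|m'ms].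
    by rewrite bounded_formD // bounded_formZ // ma mw mulr1 add0r.
  have hm' := bounded_form_dual m'.
  by rewrite bounded_formD // hw // bounded_formB // subrK.
exists (fun w => f w - f a * dual_eval m w); first exact: bounded_form_subZ.
split=> [w Aw|].
  have /fA' : A' (w - dual_eval m w *: a).
    split; first by rewrite -scaleNr addrC; exact: Alin.
    by rewrite bounded_formB // bounded_formZ // ma mulr1 subrr.
  by rewrite bounded_formB // bounded_formZ // mulrC.
by move: fv; rewrite bounded_formB // bounded_formZ // mulrC.
Qed.

Lemma weakly_closed_separation A v : c0_subspace A -> weakly_closed A -> ~ A v ->
  exists2 f, bounded_form f & (forall w, A w -> f w = 0) /\ f v <> 0.
Proof.
move=> sA clA /(weak_nbhs_forms clA) [ms h].
exact: form_separation h.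
Qed.

End BoundedForms.

(** * Power series vanishing at the powers of an element *)

Section PowerSeriesIdentity.
Context (R : realType) (K : ultrametricFieldType R).
Variables (x : K) (c : nat -> K).
Implicit Types (P Q : {poly K}) (a : K).

(** If [c j] tends to 0, these are the polynomials killed by the measure that
    puts the mass [c j] at [x ^+ j]. *)
Definition null_moment P : Prop :=
  (fun N => \sum_(0 <= j < N) c j * P.[x ^+ j]) @ \oo --> (0 : K).

Lemma null_moment_lin a P Q :
  null_moment P -> null_moment Q -> null_moment (a *: P + Q).
Proof.
move=> /ultrametric_cvgP hP /ultrametric_cvgP hQ; apply/ultrametric_cvgP => e e0.
have a1 : 0 < vabs a + 1 by rewrite ltr_wpDl ?vabs_ge0.
have := hP _ (divr_gt0 e0 a1); have := hQ e e0; apply: filterS2 => N.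
rewrite !subr0 => lQ; rewrite ltr_pdivlMr // => lP.
have -> : \sum_(0 <= j < N) c j * (a *: P + Q).[x ^+ j] =
    a * (\sum_(0 <= j < N) c j * P.[x ^+ j]) + \sum_(0 <= j < N) c j * Q.[x ^+ j].
  rewrite mulr_sumr -big_split /=; apply: eq_bigr => j _.
  by rewrite hornerD hornerZ mulrDr mulrCA.
apply: le_lt_trans (vabsD_max _ _) _; rewrite gt_max lQ andbT vabsM mulrC.
by apply: le_lt_trans lP; rewrite ler_wpM2l ?vabs_ge0 // lerDl.
Qed.

(** The induction adds a factor ['X] to the monomial, since dividing a
    polynomial by ['X] shifts its moments. *)
Lemma null_moment_poly P : (forall l, null_moment 'X^l) -> null_moment P.
Proof.
move=> hX; suff: forall l, null_moment (P * 'X^l).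
  by move=> /(_ 0%N); rewrite expr0 mulr1.
elim/poly_ind: P => [|P a IH] l.
  rewrite mul0r /null_moment; apply/ultrametric_cvgP => e e0.
  exists 0%N => // N _ /=.
  by rewrite big1 ?subr0 ?vabs0 // => j _; rewrite horner0 mulr0.
rewrite mulrDl -mulrA -exprS addrC mul_polyC.
exact: null_moment_lin.
Qed.

Definition power_prod m : {poly K} := \prod_(0 <= k < m) ('X - (x ^+ k)%:P).

Lemma power_prodE m (y : K) :
  (power_prod m).[y] = \prod_(0 <= k < m) (y - x ^+ k).
Proof.
by rewrite /power_prod horner_prod; apply: eq_bigr => k _; rewrite hornerXsubC.
Qed.

Lemma power_prod_shift m (y : K) :
  (power_prod m.+1).[x * y] = (x * y - 1) * (x ^+ m * (power_prod m).[y]).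
Proof.
rewrite !power_prodE big_nat_recl //= expr0; congr (_ * _).
elim: m => [|m IH]; first by rewrite !big_nil mulr1.
by rewrite !big_nat_recr //= IH !exprS; ring.
Qed.

Lemma power_prod_lt m j : (j < m)%N -> (power_prod m).[x ^+ j] = 0.
Proof.
move=> jm; rewrite power_prodE big_mkord (bigD1 (Ordinal jm)) //=.
by rewrite subrr mul0r.
Qed.

(** The quotients of the two sides are Gaussian binomial coefficients, which
    are polynomials in [x] with integer coefficients; the identity used is
    their Pascal rule. *)
Lemma vabs_power_prod_le m j : vabs x <= 1 ->
  vabs (power_prod m).[x ^+ j] <= vabs (power_prod m).[x ^+ m].
Proof.
move=> x1; elim: m j => [|m IHm] j; first by rewrite /power_prod big_nil !hornerE.
elim: j => [|j IHj]; first by rewrite power_prod_lt // vabs0 vabs_ge0.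
have pascal : (power_prod m.+1).[x ^+ j.+1] =
    (x ^+ m.+1 - 1) * (x ^+ m * (power_prod m).[x ^+ j])
    + x ^+ m.+1 * (power_prod m.+1).[x ^+ j].
  rewrite [x ^+ j.+1]exprS power_prod_shift (power_prodE m.+1).
  by rewrite big_nat_recr //= -power_prodE !exprS; ring.
rewrite pascal; apply: le_trans (vabsD_max _ _) _; rewrite ge_max.
apply/andP; split.
  rewrite [x ^+ m.+1 in leRHS]exprS power_prod_shift -exprS !vabsM.
  by rewrite !ler_wpM2l ?vabs_ge0.
rewrite vabsM vabsX; apply: le_trans IHj.
by rewrite ler_piMl ?vabs_ge0 // exprn_ile1 // vabs_ge0.
Qed.

(** An identity theorem for power series on the closed unit disc.  Combining
    the values at the powers of [x] according to [power_prod m] gives a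
    triangular system for the coefficients, in which each diagonal entry bounds
    the other entries of its row; so a bound for the coefficients from some index
    on propagates to all smaller indices. *)
Lemma power_series_eq0 : vabs x <= 1 -> injective (fun k => x ^+ k) ->
  (forall e : R, 0 < e -> \forall j \near \oo, vabs (c j) < e) ->
  (forall l, (fun N => \sum_(0 <= j < N) c j * (x ^+ l) ^+ j) @ \oo --> (0 : K)) ->
  forall j, c j = 0.
Proof.
move=> x1 xinj c0 hc.
have null P : null_moment P.
  apply: null_moment_poly => l; move: (hc l); rewrite /null_moment.
  under eq_fun do under eq_bigr do rewrite -exprM mulnC exprM.
  by under [in X in _ -> X]eq_fun do under eq_bigr do rewrite hornerXn.
suff small e : 0 < e -> forall m, vabs (c m) < e.
  move=> j; apply/eqP; rewrite -vabs_neq0; apply/eqP/le_anti.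
  rewrite vabs_ge0 andbT leNgt; apply/negP => /small /(_ j).
  by rewrite ltxx.
move=> e0; have [N0 _ hN0] := c0 e e0.
suff main d m : (N0 <= m + d)%N -> vabs (c m) < e.
  by move=> m; apply: (main N0); rewrite leq_addl.
elim: d m => [|d IH] m; first by rewrite addn0 => h; exact: hN0.
move=> hm; set D := (power_prod m).[x ^+ m].
have D0 : 0 < vabs D.
  rewrite vabs_gt0 /D power_prodE prodf_seq_neq0; apply/allP => k.
  rewrite mem_index_iota subr_eq0 => /andP[_ km] /=.
  by apply/eqP => /xinj mk; rewrite mk ltnn in km.
have /ultrametric_cvgP /(_ _ (mulr_gt0 e0 D0)) [N1 _ hN1] :=
  null (power_prod m).
have := hN1 (N1 + m.+1)%N (leq_addr _ _); rewrite subr0.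
rewrite (big_cat_nat (n := m)) //=; last by rewrite addnS leqW // leq_addl.
rewrite big_nat big1 ?add0r => [|j /andP[_ jm]]; last first.
  by rewrite power_prod_lt ?mulr0.
rewrite big_ltn; last by rewrite addnS ltnS leq_addl.
set T := \sum_(_ <= j < _) _ => hT.
have T1 : vabs T < e * vabs D.
  rewrite /T big_nat; apply: vabs_sum_lt => [|j /andP[mj _]]; first exact: mulr_gt0.
  rewrite vabsM.
  apply: le_lt_trans (ler_wpM2l (vabs_ge0 _) (vabs_power_prod_le m j x1)) _.
  rewrite ltr_pM2r // IH // (leq_trans hm) //.
  by rewrite addnS -addSn leq_add2r.
rewrite -(ltr_pM2r D0) -vabsM -/D -[c m * D](addrK T).
by apply: le_lt_trans (vabsD_max _ _) _; rewrite vabsN gt_max hT T1.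
Qed.

End PowerSeriesIdentity.

(** * The p-adic absolute value *)

(** By Legendre's formula the exponent is at most [k / (p - 1)]; the
    induction uses that [k / p + (k / p) / 2 <= k / 2] as soon as [3 <= p]. *)
Lemma double_logn_fact_le p k : (2 < p)%N -> prime p -> (2 * logn p k`! <= k)%N.
Proof.
move=> p2 pp; rewrite logn_fact //.
suff: forall N n, (2 * \sum_(1 <= i < N.+1) n %/ p ^ i <= n)%N by exact.
elim=> [|N IH] n; first by rewrite big_geq.
rewrite big_nat_recl // expn1 mulnDr.
under eq_bigr do rewrite expnS divnMA.
have := IH (n %/ p)%N; have := leq_trunc_div n p; nia.
Qed.

Lemma powers_eventually_lt (R : realType) (r e : R) : 0 <= r -> r <= 2^-1 ->
  0 < e -> exists N, forall k, (N <= k)%N -> r ^+ k./2 < e.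
Proof.
move=> r0 r2 e0; exists (Num.bound e^-1).*2 => k Nk.
apply: (@le_lt_trans _ _ (2^-1 ^+ k./2)); first by rewrite lerXn2r ?nnegrE ?invr_ge0.
rewrite exprVn invf_plt ?posrE ?exprn_gt0 //.
by apply: upper_nthrootP; rewrite -[leqLHS]doubleK half_leq.
Qed.

Section PadicValuation.
Context (R : realType) (p : nat) (hp : prime p) (K : padicComplexType R p).

Lemma invp_gt0 : 0 < (p%:R : R)^-1.
Proof. by rewrite invr_gt0 ltr0n prime_gt0. Qed.

Lemma invp_lt1 : (p%:R : R)^-1 < 1.
Proof. by rewrite invf_lt1 ?ltr1n ?ltr0n ?prime_gt1 ?prime_gt0. Qed.

(** A Bezout relation writes 1 as the difference of a multiple of [p] and a
    multiple of [m]; both would be small if [m] were. *)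
Lemma vabs_coprime m : coprime p m -> vabs (m%:R : K) = 1.
Proof.
move=> pm; apply/eqP; rewrite eq_le vabs_nat_le1 /= leNgt; apply/negP => m1.
have [[u v] /= uv] := coprimeP _ (prime_gt0 hp) pm.
have {}uv : (u * p = v * m + 1)%N by lia.
have mul_lt1 a b : vabs (b : K) < 1 -> vabs (a%:R * b : K) < 1.
  move=> b1; rewrite vabsM; apply: le_lt_trans b1.
  by rewrite ler_piMl ?vabs_ge0 ?vabs_nat_le1.
have : vabs (u%:R * p%:R - v%:R * m%:R : K) < 1.
  apply: le_lt_trans (vabsD_max _ _) _; rewrite vabsN gt_max !mul_lt1 //.
  by rewrite vabs_p invp_lt1.
by rewrite -!natrM uv natrD addrAC subrr add0r vabs1 ltxx.
Qed.

Lemma vabs_nat m : (0 < m)%N -> vabs (m%:R : K) = (p%:R)^-1 ^+ logn p m.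
Proof.
move=> m0; have [m' pm' {1}->] := pfactor_coprime hp m0.
by rewrite natrM natrX vabsM vabsX vabs_p vabs_coprime // mul1r.
Qed.

Lemma natr_padic_eq0 m : (m%:R == 0 :> K) = (m == 0%N).
Proof.
case: m => [|m]; first by rewrite mulr0n !eqxx.
by rewrite -vabs_neq0 vabs_nat // expf_eq0 gt_eqF ?invp_gt0 ?andbF.
Qed.

Lemma natr_padic_inj : injective (fun m : nat => m%:R : K).
Proof.
suff le a b : (a <= b)%N -> a%:R = b%:R :> K -> a = b.
  move=> a b ab; have [h|h] := leqP a b; first exact: le.
  by apply/esym/le => //; exact: ltnW.
move=> ab /eqP; rewrite eq_sym -subr_eq0 -natrB // natr_padic_eq0 subn_eq0 => ba.
by apply/eqP; rewrite eqn_leq ab.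
Qed.

Lemma Qp_ratr (r : rat) : Qp (ratr r : K).
Proof. by apply: subset_closure; exists r. Qed.

Lemma padic_int_nat m : padic_int (m%:R : K).
Proof. by split; [rewrite -ratr_nat; exact: Qp_ratr | exact: vabs_nat_le1]. Qed.

Lemma padic_intN_nat m : padic_int (- m%:R : K).
Proof.
split; last by rewrite vabsN vabs_nat_le1.
have -> : - m%:R = (- (m%:Z))%:~R :> K by rewrite mulrNz.
by rewrite -ratr_int; exact: Qp_ratr.
Qed.

Lemma ratr_natV m : (0 < m)%N -> ratr (m%:R^-1) = m%:R^-1 :> K.
Proof.
move=> m0; set r : rat := m%:R^-1.
have dE : denq r = numq r * m%:Z.
  apply/eqP; rewrite -(eqr_int rat) intrM numqE mulrAC.
  by rewrite mulVf ?mul1r // pnatr_eq0 -lt0n.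
have : (denq r)%:~R != 0 :> K.
  have := denq_gt0 r; case: (denq r) => // d d0; rewrite -pmulrn natr_padic_eq0.
  by rewrite -lt0n.
rewrite /ratr dE intrM mulf_eq0 negb_or => /andP[n0 _].
by rewrite invfM mulrA divff // mul1r.
Qed.

Lemma padic_int_natV m : coprime p m -> padic_int (m%:R^-1 : K).
Proof.
move=> pm; have m0 : (0 < m)%N.
  case: m pm => //; rewrite /coprime gcdn0 => /eqP p1.
  by have := prime_gt1 hp; rewrite p1.
split; first by rewrite -ratr_natV //; exact: Qp_ratr.
by rewrite vabsV vabs_coprime // invr1.
Qed.

(** For odd [p] the factor [z ^+ k] outweighs the denominator [k`!], in which
    [p] occurs at most [k./2] times; for [p = 2] it need not. *)
Lemma vabs_wbinomX_le (s z : K) k : (2 < p)%N -> vabs s <= 1 ->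
  vabs z <= (p%:R)^-1 -> vabs (wbinom s k * z ^+ k) <= (p%:R)^-1 ^+ k./2.
Proof.
move=> p2 s1 zp; rewrite /wbinom !vabsM vabsV vabsX vabs_nat ?fact_gt0 //.
have hk := double_logn_fact_le k p2 hp; set a := logn p k`! in hk *.
set r : R := (p%:R)^-1 in zp *; have r0 : 0 < r by exact: invp_gt0.
have prod1 : vabs (\prod_(0 <= h < k) (s - h%:R)) <= 1.
  by apply: vabs_prod_le1 => h _; rewrite vabsB_le1 ?vabs_nat_le1.
apply: (@le_trans _ _ ((r ^+ a)^-1 * r ^+ k)).
  rewrite -mulrA ler_wpM2l ?invr_ge0 ?exprn_ge0 ?(ltW r0) //.
  rewrite -[leRHS]mul1r ler_pM ?vabs_ge0 ?exprn_ge0 ?vabs_ge0 //.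
  by rewrite lerXn2r ?nnegrE ?vabs_ge0 // ltW.
have ak : (a <= k)%N by lia.
rewrite mulrC -(subnK ak) exprD mulfK ?expf_neq0 ?gt_eqF // subnK //.
by apply: ler_wiXn2l; rewrite ?(ltW r0) ?(ltW invp_lt1) //; lia.
Qed.

Lemma wbinom0 (s : K) : wbinom s 0 = 1.
Proof. by rewrite /wbinom big_geq // fact0 invr1 mulr1. Qed.

Lemma wbinom_neq0 (s : K) k : (forall m : nat, s <> m%:R) -> wbinom s k != 0.
Proof.
move=> hs; rewrite mulf_neq0 ?invr_eq0 ?natr_padic_eq0 -?lt0n ?fact_gt0 //.
rewrite prodf_seq_neq0; apply/allP => h _ /=.
by rewrite subr_eq0; apply/eqP.
Qed.

End PadicValuation.

(** * Elements of the Iwahori subgroup *)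

Section Matrices.
Context (R : realType) (p : nat) (hp : prime p) (K : padicComplexType R p).

Definition mx22 (a b c d : K) : 'M[K]_2 :=
  \matrix_(i, j) if i == 0 then if j == 0 then a else b
                 else if j == 0 then c else d.

Lemma mx22_mul a b c d a' b' c' d' : mx22 a b c d *m mx22 a' b' c' d' =
  mx22 (a * a' + b * c') (a * b' + b * d') (c * a' + d * c') (c * b' + d * d').
Proof.
apply/matrixP => i j; rewrite !mxE !big_ord_recl big_ord0 addr0 !mxE /=.
by case: (i == 0); case: (j == 0).
Qed.

Lemma mx22_1 : mx22 1 0 0 1 = 1%:M.
Proof.
by apply/matrixP => -[[|[|//]] ?] [[|[|//]] ?]; rewrite !mxE.
Qed.

Lemma mx22_iwahori a b c d a' b' c' d' :
  [/\ padic_int a, padic_int b, padic_int c & padic_int d] ->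
  [/\ padic_int a', padic_int b', padic_int c' & padic_int d'] ->
  mx22 a b c d *m mx22 a' b' c' d' = 1%:M ->
  (exists2 x, padic_int x & c = p%:R * x) ->
  iwahori (mx22 a b c d).
Proof.
move=> [ha hb hc hd] [ha' hb' hc' hd'] UV [x hx cE].
have [Uu _] := mulmx1_unit UV.
have invE : invmx (mx22 a b c d) = mx22 a' b' c' d'.
  by rewrite -[RHS](mulKmx Uu) UV mulmx1.
split; last by exists x; rewrite // mxE.
split=> // i j; rewrite ?invE mxE; by case: (i == 0); case: (j == 0).
Qed.

Lemma padic_int0 : padic_int (0 : K). Proof. exact: (padic_int_nat K 0). Qed.
Lemma padic_int1 : padic_int (1 : K). Proof. exact: (padic_int_nat K 1). Qed.

Lemma torus_iwahori m : coprime p m -> iwahori (mx22 1 0 0 (m%:R : K)).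
Proof.
move=> pm; have m0 : m%:R != 0 :> K by rewrite -vabs_neq0 vabs_coprime ?oner_eq0.
have [i0 i1] := (padic_int0, padic_int1).
apply: (@mx22_iwahori _ _ _ _ 1 0 0 (m%:R^-1)).
- by split=> //; exact: padic_int_nat.
- by split=> //; exact: padic_int_natV.
- by rewrite mx22_mul -mx22_1 divff // !mulr0 !mul0r !mulr1 !addr0 add0r.
- by exists 0; rewrite ?mulr0.
Qed.

Lemma upper_iwahori : iwahori (mx22 1 1 0 1 : 'M[K]_2).
Proof.
have [i0 i1] := (padic_int0, padic_int1).
apply: (@mx22_iwahori _ _ _ _ 1 (-1) 0 1) => //.
- by split=> //; exact: (padic_intN_nat K 1).
- by rewrite mx22_mul -mx22_1 !mulr0 !mul0r !mulr1 !addr0 !add0r mul1r addNr.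
- by exists 0; rewrite ?mulr0.
Qed.

Lemma lower_iwahori : iwahori (mx22 1 0 p%:R 1 : 'M[K]_2).
Proof.
have [i0 i1] := (padic_int0, padic_int1).
apply: (@mx22_iwahori _ _ _ _ 1 0 (- p%:R) 1) => //.
- by split=> //; exact: padic_int_nat.
- by split=> //; exact: padic_intN_nat.
- by rewrite mx22_mul -mx22_1 !mulr0 !mul0r !mulr1 !addr0 !add0r mul1r subrr.
- by exists 1; rewrite ?mulr1.
Qed.

(** The upper left entry of [invmx U *m U = 1] reads
    [V 0 0 * U 0 0 + V 0 1 * U 1 0 = 1], and the second summand is divisible
    by [p]. *)
Lemma vabs_iwahori00 (U : 'M[K]_2) : iwahori U -> vabs (U 0 0) = 1.
Proof.
move=> [[Uu Ui Vi] [x [_ x1] U10]].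
have := congr1 (fun M : 'M[K]_2 => M 0 0) (mulVmx Uu).
rewrite !mxE !big_ord_recl big_ord0 addr0 /=.
have -> : lift ord0 ord0 = 1 :> 'I_2 by apply/val_inj.
set V := invmx U => E.
have V01 : vabs (V 0 1 * U 1 0) < 1.
  rewrite U10 !vabsM vabs_p mulrCA; apply: le_lt_trans (invp_lt1 R hp).
  rewrite ler_piMr ?(ltW (invp_gt0 R hp)) //.
  by rewrite mulr_ile1 ?vabs_ge0 // (Vi 0 1).2.
have U1 : vabs (U 0 0) <= 1 := (Ui 0 0).2.
apply/le_anti; rewrite U1 leNgt; apply/negP => lU.
have : vabs (V 0 0 * U 0 0) < 1.
  rewrite vabsM; apply: le_lt_trans lU.
  by rewrite ler_piMl ?vabs_ge0 // (Vi 0 0).2.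
move=> lVU; have : vabs (1 : K) < 1.
  rewrite -[X in vabs X]E; apply: le_lt_trans (vabsD_max _ _) _.
  by rewrite gt_max lVU.
by rewrite vabs1 ltxx.
Qed.

End Matrices.

(** * Matrix coefficients of the representation *)

Section RhoCoefficients.
Context (R : realType) (p : nat) (hp : prime p) (K : padicComplexType R p).
Variable n : weight K.

Lemma padic_unit1 : padic_unit (1 : K).
Proof. by split; [|exists 1; rewrite ?mulr1 //]; exact: (padic_int_nat K 1). Qed.

Lemma wfun1 : n 1 = 1.
Proof.
have u1 := padic_unit1.
by apply: (mulfI (wfun_neq0 n u1)); rewrite -wfunM // !mulr1.
Qed.

Lemma wpow1 m : wpow n m 1 = 1.
Proof. by rewrite /wpow wfun1 exp1rz mulr1. Qed.

Lemma rho_coef_upper i j (b d : K) : rho_coef n i j (mx22 1 b 0 d) =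
  if (i <= j)%N then 'C(j, i)%:R * b ^+ (j - i) * d ^+ i else 0.
Proof.
rewrite /rho_coef !mxE /=; have [ij|ji] := leqP i j.
  rewrite big_nat_recr //= big_nat big1 => [|h /andP[_ hi]].
    by rewrite subnn wbinom0 expr0 mulr1 mul1r wpow1 mulr1 add0r.
  by rewrite expr0n subn_eq0 leqNgt hi mulr0 mul0r.
rewrite big_nat big1 // => h /andP[_ hj].
by rewrite expr0n subn_eq0 leqNgt (leq_ltn_trans _ ji) // mulr0 mul0r.
Qed.

Lemma rho_coef_lower i j (c d : K) : rho_coef n i j (mx22 1 0 c d) =
  if (j <= i)%N then wbinom (wexp n - j%:R) (i - j) * c ^+ (i - j) * d ^+ j else 0.
Proof.
rewrite /rho_coef !mxE /=; have [ji|ij] := leqP j i.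
  rewrite big_nat_recr //= big_nat big1 => [|h /andP[_ hj]].
    by rewrite binn subnn expr0 !mulr1 wpow1 mulr1 add0r.
  by rewrite expr0n subn_eq0 leqNgt hj mulr0 !mul0r.
rewrite big_nat big1 // => h /andP[_ hi].
by rewrite expr0n subn_eq0 leqNgt (leq_ltn_trans _ ij) // mulr0 !mul0r.
Qed.

Lemma rho_torus d v i : rho n (mx22 1 0 0 d) v i = d ^+ i * v i :> K.
Proof.
rewrite /rho; apply: (@limn_near_cst _ _ _ _ i.+1) => N iN.
rewrite (bigD1_seq i) ?iota_uniq ?mem_index_iota //= rho_coef_lower leqnn.
rewrite subnn wbinom0 expr0 !mul1r big1 ?addr0 // => j ji.
rewrite rho_coef_lower; case: leqP => // h; last by rewrite mul0r.
by rewrite expr0n subn_eq0 leqNgt ltn_neqAle ji h mulr0 !mul0r.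
Qed.

Lemma rho0 U : rho n U 0 = c0_val (0 : c0 K).
Proof.
apply/funext => i; apply: (@limn_near_cst _ _ _ _ 0%N) => N _.
by rewrite big1 // => j _; exact: mulr0.
Qed.

Lemma rho_series (U : 'M[K]_2) (v : c0 K) i (C : R) :
  (forall j, vabs (rho_coef n i j U) <= C) ->
  (fun N => \sum_(0 <= j < N) rho_coef n i j U * (v j : K)) @ \oo --> rho n U v i.
Proof.
move=> hC; have [l hl] := ultrametric_series_cvg (c0_bounded_mul v hC).
by rewrite /rho (ultrametric_limn hl).
Qed.

(** Apart from the binomial coefficient times the power of [U 1 0], which is
    bounded in terms of [i - h] where [h <= j], the factors of a summand have
    absolute value at most 1, except for the value of the character, which
    depends on [U] only. *)
Lemma vabs_rho_coef_le U i j : (2 < p)%N -> iwahori U ->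
  vabs (rho_coef n i j U) <= vabs (n (U 0 0)) * (p%:R)^-1 ^+ (i - j)./2.
Proof.
move=> p2 IU; have U00 := vabs_iwahori00 hp IU.
have [[_ Ui _] [x [_ x1] U10]] := IU.
have le1 a b : vabs (U a b) <= 1 := (Ui a b).2.
have r0 := ltW (invp_gt0 R hp); have r1 := ltW (invp_lt1 R hp).
rewrite /rho_coef big_nat; apply: vabs_sum_le => [|h /andP[_]].
  by rewrite mulr_ge0 ?vabs_ge0 ?exprn_ge0.
rewrite ltnS leq_min => /andP[hi hj].
set w := wbinom _ _; set t := wpow _ _ _.
have -> : w * 'C(j, h)%:R * t * U 0 1 ^+ (j - h) * U 1 0 ^+ (i - h) * U 1 1 ^+ h =
    t * ((w * U 1 0 ^+ (i - h)) * ('C(j, h)%:R * U 0 1 ^+ (j - h) * U 1 1 ^+ h)).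
  by ring.
rewrite [vabs (t * _)]vabsM /t /wpow vabsM vabs_exprz U00 exp1rz mulr1.
rewrite ler_wpM2l ?vabs_ge0 // vabsM -[leRHS]mulr1.
apply: ler_pM; rewrite ?vabs_ge0 //; last first.
  by rewrite !vabsM !vabsX !mulr_ile1 ?mulr_ge0 ?exprn_ge0 ?vabs_ge0
    ?vabs_nat_le1 ?exprn_ile1 ?vabs_ge0.
have U10p : vabs (U 1 0) <= (p%:R)^-1.
  by rewrite U10 vabsM vabs_p ler_piMr.
apply: le_trans (vabs_wbinomX_le hp _ p2 _ U10p) _.
  by rewrite vabsB_le1 ?vabs_nat_le1 ?wexp_le1.
by apply: ler_wiXn2l => //; rewrite half_leq // leq_sub2l.
Qed.

(** For a large index [i] each term of the [i]-th coordinate is small: those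
    with [j] large because [v] tends to 0, the others by the decay of the
    coefficients in [i - j]. *)
Lemma rho_c0_odd : (2 < p)%N -> rho_c0 n.
Proof.
move=> p2 U v IU; apply/tends_to0P => e e0.
set r : R := (p%:R)^-1; have r0 : 0 <= r := ltW (invp_gt0 R hp).
have r1 : r <= 1 := ltW (invp_lt1 R hp).
set C := vabs (n (U 0 0)); have C0 : 0 <= C by exact: vabs_ge0.
have hC i j : vabs (rho_coef n i j U) <= C * r ^+ (i - j)./2 by exact: vabs_rho_coef_le.
have [V V0 hV] := c0_bounded v.
have CV : 0 < C * V + 1 by rewrite ltr_wpDl // mulr_ge0 // ltW.
have C1 : 0 < C + 1 by rewrite ltr_wpDl.
have e20 : 0 < e / 2 by rewrite divr_gt0.
have /tends_to0P /(_ _ (divr_gt0 e20 C1)) [J _ hJ] := valP v.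
have [|M hM] := powers_eventually_lt r0 _ (divr_gt0 e20 CV).
  by rewrite lef_pV2 ?posrE ?ltr0n ?ler_nat // ltnW // ltnW.
exists (J + M)%N => // i /= iJM.
apply: (@le_lt_trans _ _ (e / 2)); last by rewrite ltr_pdivrMr // ltr_pMr // ltr1n.
have hl : forall j, vabs (rho_coef n i j U) <= C.
  by move=> j; apply: le_trans (hC i j) _; rewrite ler_piMr // exprn_ile1.
apply: (vabs_lim_le (rho_series (v := v) hl)) => N.
apply: vabs_sum_le => [|j _]; first exact: ltW.
rewrite vabsM; have [Jj|jJ] := leqP J j.
  apply: (@le_trans _ _ ((C + 1) * (e / 2 / (C + 1)))); last first.
    by rewrite mulrCA divff ?mulr1 // gt_eqF.
  apply: ler_pM; rewrite ?vabs_ge0 ?(ltW (hJ j Jj)) //.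
  by apply: le_trans (hl j) _; rewrite lerDl.
have rM : r ^+ (i - j)./2 <= e / 2 / (C * V + 1).
  by apply/ltW/hM; rewrite leq_subRL ?(leq_trans _ iJM) //; lia.
apply: (@le_trans _ _ ((C * (e / 2 / (C * V + 1))) * V)).
  apply: ler_pM; rewrite ?vabs_ge0 ?hV //.
  by apply: le_trans (hC i j) _; rewrite ler_wpM2l.
rewrite mulrAC mulrCA ler_piMr ?(ltW e20) // ler_pdivrMr // mul1r.
by rewrite lerDl.
Qed.

End RhoCoefficients.

(** * Stable subspaces *)

Section Subrepresentations.
Context (R : realType) (p : nat) (hp : prime p) (K : padicComplexType R p).
Variable n : weight K.
Implicit Types (A : set (c0 K)) (v w : c0 K).

(** The diagonal matrices with entries 1 and [(1 + p) ^ l] multiply the [j]-th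
    coordinate by [((1 + p) ^ l) ^ j].  Applied to the translates of [v] by them,
    the relation [L] says that the power series with coefficients [L j * v j]
    vanishes at all powers of [1 + p]. *)
Lemma weight_separation A (L : nat -> K) (C : R) : subrep n A ->
  (forall j, vabs (L j) <= C) ->
  (forall v, A v -> (fun N => \sum_(0 <= j < N) L j * (v j : K)) @ \oo --> (0 : K)) ->
  forall v, A v -> forall j, L j * (v j : K) = 0.
Proof.
move=> [_ stA] hC hA v Av.
have x1 : vabs ((1 + p)%:R : K) <= 1 by exact: vabs_nat_le1.
apply: (power_series_eq0 x1) => [k l /= | | l].
- rewrite -!natrX => /(natr_padic_inj hp) /eqP.
  by rewrite eqn_exp2l ?add1n ?ltnS ?prime_gt0 // => /eqP.
- exact: c0_bounded_mul.
have cop : coprime p ((1 + p) ^ l) by rewrite add1n coprimeXr // coprimenS.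
have [w Aw wE] := stA _ _ (torus_iwahori hp K cop) Av.
have E N : \sum_(0 <= j < N) L j * (w j : K) =
    \sum_(0 <= j < N) L j * (v j : K) * ((1 + p)%:R ^+ l) ^+ j.
  by apply: eq_bigr => j _; rewrite wE rho_torus natrX; ring.
by have := hA w Aw; rewrite (funext E).
Qed.

(** A bounded form [f] that kills [A] is a relation among the coordinates whose
    coefficients are the values of [f] on the unit vectors.  Separating the
    weights, the [i]-th coordinate vanishes on [A] wherever the [i]-th
    coefficient does not. *)
Lemma coordinate_vanishes A v0 : subrep n A -> weakly_closed A -> ~ A v0 ->
  exists i, forall w, A w -> w i = 0 :> K.
Proof.
move=> sA clA nAv; have [f hf [fA fv]] := weakly_closed_separation sA.1 clA nAv.
have [[i fi]|h] := pselect (exists i, f (c0_delta K i) <> 0); last first.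
  case: fv; have fd j : f (c0_delta K j) = 0.
    by apply: contra_notP h => ?; exists j.
  rewrite -(ultrametric_limn (bounded_form_series (v := v0) hf)).
  apply: (@limn_near_cst _ _ _ _ 0%N) => N _.
  by rewrite big1 // => j _; rewrite fd mul0r.
exists i => w Aw; have [_ [C hC]] := hf.
have C0 j : C * c0_norm (c0_delta K j) <= `|C|.
  apply: le_trans (ler_wpM2r (c0_norm_ge0 _) (ler_norm C)) _.
  rewrite ler_piMr // c0_norm_le // => k.
  exact: vabs_nat_le1.
have : f (c0_delta K i) * (w i : K) = 0.
  apply: (weight_separation (L := fun j => f (c0_delta K j)) sA _ _ Aw) => [j|u Au].
    exact: le_trans (hC _) (C0 j).
  by have := bounded_form_series (v := u) hf; rewrite (fA u Au).
by move/eqP; rewrite mulf_eq0 => /orP[/eqP //|/eqP].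
Qed.

(** The vanishing of the [i]-th coordinate of [rho n U v] for all [v] in [A] is
    again a relation, with coefficients [rho_coef n i j U].  The coefficient at
    [j] is the binomial coefficient of [j] over [i] for the upper unipotent [U]
    when [i <= j].  When [j <= i], for the lower unipotent [U], it is a power of
    [p] times a binomial coefficient of [n - j], and this is where the exponent
    must not be a natural number. *)
Lemma vanishing_coordinate A i : (forall m : nat, wexp n <> m%:R) ->
  subrep n A -> (forall w, A w -> w i = 0 :> K) -> forall v, A v -> v = 0.
Proof.
move=> hn sA Ai v Av; apply/val_inj/funext => j; change (v j = 0 :> K).
have unip U (C : R) : iwahori U -> (forall k, vabs (rho_coef n i k U) <= C) ->
    rho_coef n i j U != 0 -> v j = 0 :> K.
  move=> IU hC nz.
  have /eqP : rho_coef n i j U * (v j : K) = 0.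
    apply: (weight_separation (L := fun k => rho_coef n i k U) sA hC _ Av) => u Au.
    have [w Aw wE] := sA.2 U u IU Au.
    by have := rho_series (v := u) hC; rewrite -wE (Ai w Aw).
  by rewrite mulf_eq0 (negbTE nz) => /eqP.
have [ij|ji] := leqP i j.
  apply: (unip _ 1 (@upper_iwahori _ _ K)) => [k|].
    rewrite rho_coef_upper !expr1n !mulr1; case: ifP => _; first exact: vabs_nat_le1.
    by rewrite vabs0 ler01.
  by rewrite rho_coef_upper ij !expr1n !mulr1 natr_padic_eq0 // -lt0n bin_gt0.
(* Only finitely many entries of the [i]-th row are nonzero. *)
apply: (unip _ (\sum_(k < i.+1) vabs (rho_coef n i k (mx22 1 0 p%:R 1)))
         (@lower_iwahori _ _ K)) => [k|].
  have [ki|ik] := leqP k i; last first.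
    rewrite rho_coef_lower leqNgt ik vabs0.
    by apply: sumr_ge0 => l _; exact: vabs_ge0.
  rewrite (bigD1 (Ordinal (ki : (k < i.+1)%N))) //= lerDl.
  by apply: sumr_ge0 => l _; exact: vabs_ge0.
rewrite rho_coef_lower ltnW // expr1n mulr1 mulf_neq0 //.
  apply: wbinom_neq0 => // m /eqP; rewrite subr_eq -natrD => /eqP.
  exact: hn.
by rewrite expf_neq0 // natr_padic_eq0 // -lt0n prime_gt0.
Qed.

Lemma subrep0 : subrep n [set 0].
Proof.
split=> [|U v _ ->]; first by split=> // a u v -> ->; rewrite scaler0 addr0.
by exists 0; rewrite ?rho0.
Qed.

Lemma subrepT : rho_c0 n -> subrep n setT.
Proof. by move=> h; split=> // U v IU _; exists (C0 (h U v IU)). Qed.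

End Subrepresentations.

Theorem theorem6p6 (R : realType) (p : nat) (hp : prime p)
    (Cp : padicComplexType R p) (n : weight Cp)
    (hn : forall m : nat, wexp n <> m%:R)
    (h2 : p = 2%N -> rho_c0 n) :
  weakly_irreducible n.

Proof.
have hrho : rho_c0 n.
  have [/h2 //|p2] := eqVneq p 2%N.
  by apply: rho_c0_odd => //; rewrite ltn_neqAle eq_sym p2 prime_gt1.
have trivial A : subrep n A -> weakly_closed A -> A = [set 0] \/ A = setT.
  move=> sA clA; have [->|nT] := pselect (A = setT); [by right | left].
  have [v nAv] : exists v, ~ A v.
    apply: contra_notP nT => h; apply/seteqP; split=> // v _.
    by apply: contra_notP h => ?; exists v.
  have [i Ai] := coordinate_vanishes hp sA clA nAv.
  apply/seteqP; split=> [w Aw|w ->]; last exact: sA.1.1.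
  exact: (vanishing_coordinate hp hn sA Ai).
apply/eq_cardSP; exists setT.
  by split; [exact: subrepT | exact: closedT].
have -> : [set A | subrep n A /\ weakly_closed A] `\ setT = [set [set 0]].
  apply/seteqP; split=> [A [[sA clA] nT]|A ->].
    by case: (trivial A sA clA).
  split; first by split; [exact: subrep0 | exact: weakly_closed0].
  move=> E; have : [set (0 : c0 Cp)] (c0_delta Cp 0) by rewrite E.
  move=> /(congr1 (fun v : c0 Cp => v 0%N : Cp)) /eqP.
  by rewrite (_ : _ 0%N = 1) ?oner_eq0.
exact: card_set1.
Qed.
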